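(* Let $P$ be an incremental single while loop $\textbf{while}~\phi~\textbf{do}~Q~\textbf{od}$ (as described in the context) with loop-body function $F(\mathbf{v},\mathbf{u})=\mathbf{v}+\mathbf{A}\mathbf{u}$. If there exists a linear progress function for $P$, then for every initial program valuation $\mathbf{v}_0\in\mathbb{Z}^{|X|}$, the termination time $T$ of $P$ started from $(\mathtt{in},\mathbf{v}_0)$ satisfies $\mathbb{P}(T<\infty)=1$.
   Context: Setting. $P$ has integer program variables $x_1,\dots,x_{|X|}$ and integer sampling variables $r_1,\dots,r_{|R|}$; $\phi$ is a Boolean predicate over program variables and $\mathbf{v}\models\phi$ means valuation $\mathbf{v}\in\mathbb{Z}^{|X|}$ satisfies it. Each sampling variable $r_i$ has a discrete distribution $\Upsilon(r_i)$ on $\mathbb{Z}$, with mean $\mu_i$ and variance $\sigma_i^2$ (assumed finite); at each loop iteration the vector $\mathbf{u}\in\mathbb{Z}^{|R|}$ of sampled values is drawn afresh, independently of the past, with the $r_i$ independent of each other, i.e. with distribution $\bar{\Upsilon}(\mathbf{u})=\prod_i\Upsilon(r_i)(\mathbf{u}[i])$. $P$ is incremental: $Q$ is a sequential composition of assignments of the form $x:=x+\sum_{i=1}^{|R|}c_i r_i$ with $x$ a program variable and $c_i$ constants, so the body transforms valuation $\mathbf{v}$ into $F(\mathbf{v},\mathbf{u})=\mathbf{v}+\mathbf{A}\mathbf{u}$ for a constant matrix $\mathbf{A}\in\mathbb{Z}^{|X|\times|R|}$. Semantics: a Markov chain on $\{\mathtt{in},\mathtt{out}\}\times\mathbb{Z}^{|X|}$: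 from $(\mathtt{in},\mathbf{v})$ with $\mathbf{v}\models\phi$ move to $(\mathtt{in},F(\mathbf{v},\mathbf{u}))$ with $\mathbf{u}$ sampled from $\bar{\Upsilon}$; from $(\mathtt{in},\mathbf{v})$ with $\mathbf{v}\not\models\phi$ move to $(\mathtt{out},\mathbf{v})$; $(\mathtt{out},\mathbf{v})$ is absorbing. Starting from $(\mathtt{in},\mathbf{v}_0)$ this gives a random path $\{(\ell_n,\mathbf{v}_n)\}_{n\ge0}$ and measure $\mathbb{P}$; $T:=\min\{n\mid\ell_n=\mathtt{out}\}$ (with $\min\emptyset=\infty$). Definition. A linear progress function for $P$ is a function $h:\mathbb{Z}^{|X|}\to\mathbb{R}$ such that (L1) there exist $\mathbf{a}\in\mathbb{R}^{|X|}$ and $c\in\mathbb{R}$ with $h(\mathbf{v})=\mathbf{a}^{\mathrm{T}}\mathbf{v}+c$ for all $\mathbf{v}$; (L2) for all $\mathbf{v}$, $\mathbf{v}\models\phi$ implies $h(\mathbf{v})>0$; (L3) writing $(a_1,\dots,a_{|R|})=\mathbf{a}^{\mathrm{T}}\mathbf{A}$, one has $\sum_{i=1}^{|R|}a_i\mu_i\le 0$ and $\sum_{i=1}^{|R|}a_i^2\sigma_i^2>0$. *)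

(* Defs.v *)
From HB Require Import structures.
From mathcomp Require Import all_boot all_order all_algebra.
From mathcomp Require Import all_classical all_reals all_analysis.

Set Implicit Arguments.
Unset Strict Implicit.
Unset Printing Implicit Defensive.

Import Order.TTheory GRing.Theory Num.Theory.

Local Open Scope classical_set_scope.
Local Open Scope ring_scope.

(* Z carries the discrete sigma-algebra, so that a discrete distribution on Z
   is an element of [probability int R]. *)
HB.instance Definition _ := isPointed.Build int 0.
HB.instance Definition _ := @isMeasurable.Build default_measure_display
  int (@discrete_measurable int) (@discrete_measurable0 int)
  (@discrete_measurableC int) (@discrete_measurableU int).

(* The assignment  x_target := x_target + \sum_k coef 0 k * r_k. *)
Record assignment (nX nR : nat) := Assign {
  target : 'I_nX;
  coef : 'rV[int]_nR
}.

Record incremental_loop (R : realType) (nX nR : nat) := IncrementalLoop {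
  guard : pred 'cV[int]_nX;
  body : seq (assignment nX nR);
  sampling : 'I_nR -> probability int R
}.

Definition exec_assign (nX nR : nat) (u : 'cV[int]_nR) (v : 'cV[int]_nX)
    (a : assignment nX nR) : 'cV[int]_nX :=
  \col_i (if i == target a
          then v i 0 + \sum_(k < nR) coef a 0 k * u k 0
          else v i 0).

Definition body_fun (nX nR : nat) (Q : seq (assignment nX nR))
    (v : 'cV[int]_nX) (u : 'cV[int]_nR) : 'cV[int]_nX :=
  foldl (exec_assign u) v Q.

(* The matrix A of the body; see [body_funE]. *)
Definition body_mx (nX nR : nat) (Q : seq (assignment nX nR)) :
    'M[int]_(nX, nR) :=
  \matrix_(i, k) \sum_(a <- Q | target a == i) coef a 0 k.

Lemma body_funE (nX nR : nat) (Q : seq (assignment nX nR)) v u :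
  body_fun Q v u = v + body_mx Q *m u.
Proof.
rewrite /body_fun; elim: Q v => [|a Q IH] v /=.
  apply/matrixP => i j; rewrite !mxE big1 ?addr0// => k _.
  by rewrite !mxE big_nil mul0r.
rewrite IH; apply/matrixP => i j; rewrite !mxE ord1 [in LHS]eq_sym.
under [in RHS]eq_bigr => k _ do rewrite mxE big_cons.
under [X in _ + X = _]eq_bigr => k _ do rewrite [body_mx _ _ _]mxE.
case: eqP => // _; rewrite -addrA -big_split/=; congr (_ + _).
by apply: eq_bigr => k _; rewrite mulrDl.
Qed.

Section semantics.
Context (R : realType) (nX nR : nat).
Variable P : incremental_loop R nX nR.
Local Open Scope ereal_scope.

Definition mean (k : 'I_nR) : R := fine 'E_(sampling P k)[intr].

Definition var (k : 'I_nR) : R := fine 'V_(sampling P k)[intr].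

Definition finite_variance : Prop :=
  forall k : 'I_nR, (intr : int -> R) \in Lfun (sampling P k) 2%:E.

Definition joint_pmf (u : 'cV[int]_nR) : \bar R :=
  \prod_(k < nR) sampling P k [set u k ord0].

Inductive location := Lin | Lout.

Definition configuration : Type := location * 'cV[int]_nX.

Definition transition (s s' : configuration) : \bar R :=
  match s with
  | (Lin, v) =>
      if guard P v then
        match s' with
        | (Lin, v') =>
            \esum_(u in [set u | body_fun (body P) v u = v']) joint_pmf u
        | (Lout, _) => 0
        end
      else (\1_[set (Lout, v)] s')%:E
  | (Lout, v) => (\1_[set (Lout, v)] s')%:E
  end.

(* X is a (realization of the) Markov chain of P started from s0.  The law of
   such a process, hence the probability of every event it determines, is
   uniquely fixed by these conditions. *)
Record loop_chain (d : measure_display) (Omega : measurableType d)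
    (Pr : probability Omega R) (s0 : configuration)
    (X : nat -> Omega -> configuration) : Prop := LoopChain {
  chain_measurable : forall n s, measurable (X n @^-1` [set s]);
  chain_init : Pr [set w | X 0%N w = s0] = 1;
  chain_step : forall (n : nat) (s : nat -> configuration),
    Pr [set w | forall i, (i <= n.+1)%N -> X i w = s i] =
    Pr [set w | forall i, (i <= n)%N -> X i w = s i]
      * transition (s n) (s n.+1)
}.

(* The infimum over an empty set is +oo. *)
Definition termination_time (Omega : Type)
    (X : nat -> Omega -> configuration) (w : Omega) : \bar R :=
  ereal_inf [set n%:R%:E | n in [set n : nat | (X n w).1 = Lout]].

Definition linear_progress_function (h : 'cV[int]_nX -> R) : Prop :=
  exists (a : 'cV[R]_nX) (c : R),
    let alpha := (a^T *m map_mx intr (body_mx (body P)))%R in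
    [/\ forall v, h v = ((a^T *m map_mx intr v) 0 0 + c)%R,
        forall v, guard P v -> (0 < h v)%R,
        (\sum_(k < nR) alpha 0 k * mean k <= 0)%R
      & (0 < \sum_(k < nR) alpha 0 k ^+ 2 * var k)%R].

End semantics.

(* Main.v *)
(**
Let Y be the increment of the progress function h in one iteration, so that
E Y <= 0 and P(Y <> 0) > 0, and let q(x) be the probability that the walk
started at x with i.i.d. steps distributed as Y stays positive forever; it
dominates the probability that the loop runs forever from any v with h(v) = x.
The function q is nondecreasing, vanishes on x <= 0, and satisfies
q(x) = E q(x + Y) for x > 0.  Summing this identity over x = dl, 2dl, .., N dl
makes the sum telescope up to boundary terms: with s the limit of q, letting
N tend to infinity gives  s (E Y + dl) >= dl * E (sum of q(i dl) over
0 < i <= ceil(Y / dl)),  which is at least q(e) E max(0, Y - e) for every e > 0.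
Letting dl tend to 0, either s = 0, or E Y = 0 and q(e) E max(0, Y - e) = 0
for all e > 0.  In the second case E max(0, Y - e) > 0 for some e > 0, so
q(e) = 0, and harmonicity propagates this zero to 2e, 3e, ..
*)
Require Import Defs.
From HB Require Import structures.
From mathcomp Require Import all_boot all_order all_algebra.
From mathcomp Require Import all_classical all_reals all_analysis.
From mathcomp Require Import measurable_realfun ring lra.
Set Implicit Arguments.
Unset Strict Implicit.
Unset Printing Implicit Defensive.

Import Order.TTheory GRing.Theory Num.Theory.
Import numFieldNormedType.Exports.

Local Open Scope classical_set_scope.
Local Open Scope ring_scope.

(** * Real-valued integrals on a probability space where every set is measurable *)

Section DiscreteRintegral.
Context d (T : measurableType d) (R : realType) (mu : probability T R).
Hypothesis discr : forall A : set T, measurable A.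
Implicit Types f g : T -> R.

Lemma discrete_measurable_fun d' (T' : sigmaRingType d') (f : T -> T') :
  measurable_fun setT f.
Proof. by move=> _ B mB; exact: discr. Qed.

Arguments discrete_measurable_fun {d' T'} f _ Y _.

Lemma dominated_integrable_real f g : mu.-integrable setT (EFin \o g) ->
  (forall t, `|f t| <= g t) -> mu.-integrable setT (EFin \o f).
Proof.
move=> ig fg; apply: (le_integrable _ _ _ ig) => //.
move=> t _ /=; rewrite lee_fin; apply: (le_trans (fg t)).
by rewrite ler_norm.
Qed.

Lemma integrable_cst_real (r : R) : mu.-integrable setT (EFin \o (fun=> r)).
Proof. exact: finite_measure_integrable_cst. Qed.

Lemma bounded_integrable_real f (r : R) : (forall t, `|f t| <= r) ->
  mu.-integrable setT (EFin \o f).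
Proof. by move=> fr; apply: dominated_integrable_real fr; exact: integrable_cst_real. Qed.

Lemma integrableD_real f g : mu.-integrable setT (EFin \o f) ->
  mu.-integrable setT (EFin \o g) ->
  mu.-integrable setT (EFin \o (fun t => f t + g t)).
Proof.
move=> fi gi; rewrite (_ : _ \o _ = (EFin \o f) \+ (EFin \o g))%E//.
exact: integrableD.
Qed.

Lemma integrableB_real f g : mu.-integrable setT (EFin \o f) ->
  mu.-integrable setT (EFin \o g) ->
  mu.-integrable setT (EFin \o (fun t => f t - g t)).
Proof.
move=> fi gi; rewrite (_ : _ \o _ = (EFin \o f) \- (EFin \o g))%E//.
exact: integrableB.
Qed.

Lemma integrableZ_real (r : R) f : mu.-integrable setT (EFin \o f) ->
  mu.-integrable setT (EFin \o (fun t => r * f t)).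
Proof. by move=> fi; exact: (integrableZl measurableT r fi). Qed.

Lemma Rintegral_prob_cst (r : R) : \int[mu]_t r = r.
Proof. by rewrite (Rintegral_cst _ measurableT)/= probability_setT/= mulr1. Qed.

Lemma Rdominated_convergence (f_ : nat -> T -> R) f g :
  mu.-integrable setT (EFin \o g) -> (forall n t, `|f_ n t| <= g t) ->
  (forall t, f_ ^~ t @ \oo --> f t) ->
  (fun n => \int[mu]_t f_ n t) @ \oo --> \int[mu]_t f t.
Proof.
move=> ig fg cf.
have [fi _ cv] := @dominated_convergence _ _ _ mu setT measurableT
  (fun n => EFin \o f_ n) (EFin \o f) (EFin \o g)
  (fun=> discrete_measurable_fun _) (discrete_measurable_fun _)
  ltac:(by apply: aeW => t _; apply: cvg_EFin; [exact: nearW|exact: cf])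
  ig ltac:(by apply: aeW => t n _ /=; rewrite lee_fin).
apply: fine_cvg; rewrite fineK//; exact: integrable_fin_num.
Qed.

(** Both claims share one induction, since linearity at each step needs the integrability of the
    tail. *)
Lemma Rintegral_sum (I : Type) (r : seq I) (F : I -> T -> R) :
  (forall i, mu.-integrable setT (EFin \o F i)) ->
  mu.-integrable setT (EFin \o (fun t => \sum_(i <- r) F i t)) /\
  \int[mu]_t (\sum_(i <- r) F i t) = \sum_(i <- r) \int[mu]_t F i t.
Proof.
move=> iF; elim: r => [|i r [IH1 IH2]].
  rewrite (_ : (fun _ => _) = fun=> 0); last by apply/funext => t; rewrite big_nil.
  by split; [exact: integrable_cst_real|rewrite big_nil Rintegral_prob_cst].
rewrite (_ : (fun _ => _) = fun t => F i t + \sum_(j <- r) F j t); last first.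
  by apply/funext => t; rewrite big_cons.
split; first exact: integrableD_real.
by rewrite RintegralD// IH2 big_cons.
Qed.

End DiscreteRintegral.

(** * Telescoping sums of a bounded monotone sequence on the integers *)

Section ShiftedLatticeSums.
Context (R : realType) (b : int -> R) (s p e : R).
Hypothesis b_nd : forall i j, i <= j -> b i <= b j.
Hypothesis b_ge0 : forall i, 0 <= b i.
Hypothesis b_le1 : forall i, b i <= 1.
Hypothesis b_npos : forall i, i <= 0 -> b i = 0.
Hypothesis b_cvg : (fun n : nat => b n%:Z) @ \oo --> s.
Hypotheses (p_ge0 : 0 <= p) (e_ge0 : 0 <= e).
Hypothesis b_ge : forall i : int, e <= i%:~R -> p <= b i.

(** The base points are 1 to [N], because harmonicity is available only at positive points. *)
Definition shift_sum (k : int) (N : nat) : R :=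
  \sum_(i < N) (b (i.+1%:Z + k) - b i.+1%:Z).

Lemma shift_sum0 N : shift_sum 0 N = 0.
Proof. by rewrite /shift_sum big1// => i _; rewrite addr0 subrr. Qed.

(** Two consecutive shifts differ by the sum of [b (i + k + 1) - b (i + k)] over [0 < i <= N], which
    telescopes to its boundary terms. *)
Lemma shift_sumS k N :
  shift_sum (k + 1) N = shift_sum k N + (b (N%:Z + (k + 1)) - b (k + 1)).
Proof.
rewrite /shift_sum; elim: N => [|N IH]; first by rewrite !big_ord0 !add0r subrr.
rewrite !big_ord_recr/= IH.
rewrite (_ : (N.+1 : int) + k = N%:Z + (k + 1)); first by lra.
by rewrite -addn1 PoszD; ring.
Qed.

Lemma lattice_shift_cvg (k : int) : (fun N : nat => b (N%:Z + k)) @ \oo --> s.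
Proof.
case: k => m.
  rewrite (_ : (fun _ => _) = (fun n => b (n + m)%N))//.
  by rewrite (cvg_shiftn m (fun n : nat => b n)).
rewrite -(cvg_shiftn m.+1) /=.
rewrite (_ : (fun _ => _) = (fun n : nat => b n))//.
by apply/funext => n; rewrite NegzE PoszD addrK.
Qed.

(* The limit is computed exactly for k <= 0 and only bounded above for k > 0,
   where it equals the sum of s - b i over 0 < i <= k. *)
Definition shift_sum_spec (k : int) :=
  (forall N, `|shift_sum k N| <= `|k%:~R|) /\
  exists2 L, shift_sum k @ \oo --> L &
    L <= s * k%:~R - p * Num.max 0 (k%:~R - e) /\ (k <= 0 -> L = s * k%:~R).

(** Induction on [k] in both directions from 0. By [shift_sumS] a unit step changes the sum by at
    most 1, and its limit by [s] minus a value of [b]; that value is at least [p] from [e] on and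
    zero at nonpositive arguments. *)
Lemma shift_sumP k : shift_sum_spec k.
Proof.
have step j N : `|b (N%:Z + j) - b j| <= 1.
  have := b_ge0 (N%:Z + j); have := b_ge0 j.
  have := b_le1 (N%:Z + j); have := b_le1 j.
  by move=> *; rewrite ler_norml; apply/andP; split; lra.
have intS (j : int) : (j + 1)%:~R = j%:~R + 1 :> R by rewrite intrD.
elim/int_ind: k => [|n [bd [L cL [leL _]]]|n [bd [L cL [leL eqL]]]].
- split=> [N|]; first by rewrite shift_sum0 normr0.
  exists 0; last by split=> [|_]; rewrite mulr0// max_l ?mulr0 ?subrr// sub0r oppr_le0.
  rewrite (_ : shift_sum 0 = fun=> 0); first exact: cvg_cst.
  by apply/funext => N; rewrite shift_sum0.
- have nS : n.+1 = (n : int) + 1 :> int by rewrite -addn1 PoszD.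
  rewrite nS; split=> [N|].
    rewrite shift_sumS (le_trans (ler_normD _ _))//.
    have := bd N; have := step (n%:Z + 1) N; rewrite intS.
    have n0 : 0 <= n%:~R :> R by rewrite ler0z.
    by rewrite [`|n%:~R|]ger0_norm// [`|n%:~R + 1|]ger0_norm ?addr_ge0//; lra.
  exists (L + (s - b (n%:Z + 1))).
    rewrite (_ : shift_sum _ =
      fun N => shift_sum n N + (b (N%:Z + (n%:Z + 1)) - b (n%:Z + 1))); last first.
      by apply/funext => N; rewrite shift_sumS.
    apply: cvgD => //; apply: cvgB; first exact: lattice_shift_cvg.
    exact: cvg_cst.
  split; last by move=> /= n0; exfalso; move: n0; rewrite -nS.
  move: leL; rewrite intS/=.
  have b0 := b_ge0 (n%:Z + 1).
  have := @b_ge (n%:Z + 1); rewrite intS.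
  (* If [n + 1] has reached [e], then [b (n + 1) >= p] pays for the growth of the positive part,
     which is at most 1; otherwise the positive part is still 0. *)
  have [en /(_ isT) pb|ne _] := leP e _.
    set x := n%:~R in en *; set m := Num.max _ _; set m' := Num.max _ _.
    have : m' <= m + 1.
      have m0 : 0 <= m by rewrite le_max lexx.
      have m1 : x - e <= m by rewrite le_max lexx orbT.
      by rewrite /m' ge_max; apply/andP; split; lra.
    by move=> mm'; have := ler_wpM2l p_ge0 mm'; rewrite mulrDr; lra.
  rewrite [Num.max 0 _ in X in _ -> X]max_l; last by lra.
  have : 0 <= Num.max 0 (n%:~R - e) by rewrite le_max lexx.
  by move=> /(mulr_ge0 p_ge0); lra.
- have nS : - (n : int) = - (n.+1 : int) + 1 by rewrite -addn1 PoszD; ring.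
  (* As [b] vanishes here, one step down removes exactly [s] from the limit, so its exact value
     persists. *)
  have bn : b (- (n : int)) = 0 by apply: b_npos; rewrite oppr_le0.
  have E N : shift_sum (- n.+1%:Z) N = shift_sum (- n%:Z) N - b (N%:Z - n%:Z).
    by have := shift_sumS (- n.+1%:Z) N; rewrite -nS bn => ->; ring.
  have nR : (- n.+1%:Z)%:~R = (- n%:Z)%:~R - 1 :> R by rewrite nS intS addrK.
  have n0 : (- n%:Z)%:~R <= 0 :> R by rewrite lerz0 oppr_le0.
  split=> [N|].
    rewrite E (le_trans (ler_normB _ _))//.
    have := bd N; have := step (- n%:Z) N; rewrite bn subr0 nR.
    rewrite (ler0_norm n0) [`|_ - 1|]ler0_norm; last by lra.
    lra.
  exists (L - s).
    rewrite (_ : shift_sum _ = fun N => shift_sum (- n%:Z) N - b (N%:Z - n%:Z)); last exact/funext.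
    by apply: cvgB => //; exact: lattice_shift_cvg.
  rewrite nR; split; last by rewrite eqL ?oppr_le0// => _; ring.
  rewrite eqL ?oppr_le0// max_l; first by lra.
  by rewrite subr_le0 (le_trans _ e_ge0)// lerBlDr (le_trans n0)// add0r.
Qed.

End ShiftedLatticeSums.

Lemma cvg_ge_cst (R : realType) (u : nat -> R) (l a : R) :
  u @ \oo --> l -> (forall n, a <= u n) -> a <= l.
Proof.
move=> ul au; rewrite -(cvg_lim _ ul)//; apply: limr_ge; first by apply/cvg_ex; exists l.
exact: nearW.
Qed.

Lemma cvg_le_cst (R : realType) (u : nat -> R) (l a : R) :
  u @ \oo --> l -> (forall n, u n <= a) -> l <= a.
Proof.
move=> ul au; rewrite -(cvg_lim _ ul)//; apply: limr_le; first by apply/cvg_ex; exists l.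
exact: nearW.
Qed.

(** * Bounded monotone functions harmonic for a walk without upward drift *)

Section HarmonicFunctions.
Context d (T : measurableType d) (R : realType) (mu : probability T R).
Hypothesis discr : forall A : set T, measurable A.
Variables (Y : T -> R) (q : R -> R).
Hypothesis Y_int : mu.-integrable setT (EFin \o Y).
Hypothesis Y_drift : \int[mu]_t Y t <= 0.
Hypothesis Y_nonzero : 0 < \int[mu]_t `|Y t|.
Hypothesis q_nd : forall x y, x <= y -> q x <= q y.
Hypothesis q_ge0 : forall x, 0 <= q x.
Hypothesis q_le1 : forall x, q x <= 1.
Hypothesis q_npos : forall x : R, x <= 0 -> q x = 0.
Hypothesis q_harmonic : forall x : R, 0 < x -> q x = \int[mu]_t q (x + Y t).

Let excess (e : R) (t : T) : R := Num.max 0 (Y t - e).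

Let excess_int e : mu.-integrable setT (EFin \o excess e).
Proof.
apply: (dominated_integrable_real discr (g := fun t => `|Y t| + `|e|)).
  apply: integrableD_real => //; last exact: integrable_cst_real.
  exact: integrable_norm.
move=> t; rewrite /excess ger0_norm ?le_max ?lexx// ge_max addr_ge0//=.
by rewrite (le_trans (ler_norm _))// ler_normB.
Qed.

(* Here s is the limit of q along the grid of the multiples of dl, and Y is
   rounded up to that grid, at the cost of the term dl. *)
Lemma harmonic_drift_le (e dl : R) : 0 < e -> 0 < dl ->
  exists s : R, [/\ 0 <= s <= 1, forall n : nat, q (n%:R * dl) <= s &
    q e * \int[mu]_t excess e t <= s * (\int[mu]_t Y t + dl)].
Proof.
move=> e0 dl0.
pose b (i : int) := q (i%:~R * dl).
have b_nd i j : i <= j -> b i <= b j.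
  by move=> ij; apply: q_nd; rewrite ler_pM2r// ler_int.
have b_npos i : i <= 0 -> b i = 0.
  by move=> i0; apply: q_npos; rewrite pmulr_lle0// lerz0.
have [s b_cvg] : exists s : R, (fun n : nat => b n%:Z) @ \oo --> s.
  exists (sup (range (fun n : nat => b n%:Z))).
  have nd : {homo (fun n : nat => b n%:Z) : n m / (n <= m)%N >-> n <= m}.
    by move=> n m nm; exact: b_nd.
  apply (nondecreasing_cvgn nd).
  by exists 1 => _ [n _ <-]; exact: q_le1.
have s0 : 0 <= s.
  by apply: (cvg_ge_cst b_cvg) => n; exact: q_ge0.
have s1 : s <= 1.
  by apply: (cvg_le_cst b_cvg) => n; exact: q_le1.
have b_ge (i : int) : e / dl <= i%:~R -> q e <= b i.
  by rewrite ler_pdivrMr// => ei; exact: q_nd.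
pose K t := Num.ceil (Y t / dl).
have [KL KU] : (forall t, Y t / dl <= (K t)%:~R) /\ (forall t, (K t)%:~R <= Y t / dl + 1).
  split=> t; have /andP[] := ceil_itv (Y t / dl) => //.
  by rewrite intrB => h _; move: h; rewrite -/(K t); lra.
(* The threshold [e / dl] is [e] measured in grid steps, and [q e] is the lower bound of [b] beyond
   it. *)
have spec t := @shift_sumP R b s (q e) (e / dl) (fun i => q_ge0 _) (fun i => q_le1 _)
  b_npos b_cvg (q_ge0 e) (divr_ge0 (ltW e0) (ltW dl0)) b_ge (K t).
pose L (t : T) : R := lim (shift_sum b (K t) @ \oo).
have cL t : shift_sum b (K t) @ \oo --> L t.
  by have [_ [l cl _]] := spec t; rewrite /L (cvg_lim _ cl).
(* Each occurrence of [K] is replaced by the side of its bracket that weakens the bound: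
   [K <= Y / dl + 1] in the term with [s], [K >= Y / dl] in the subtracted one. *)
have leL t : L t <= s * (Y t / dl + 1) - q e * (excess e t / dl).
  have [_ [l cl [ll _]]] := spec t; rewrite /L (cvg_lim _ cl)//.
  apply: (le_trans ll); apply: lerB; first by apply: ler_wpM2l.
  apply: ler_wpM2l => //; rewrite ler_pdivrMr// /excess ge_max.
  rewrite mulr_ge0 ?le_max ?lexx ?(ltW dl0)//=.
  rewrite -ler_pdivrMr// le_max mulrBl; apply/orP; right.
  by rewrite lerB.
(* An upper bound of the absolute value of [K t], hence an integrable bound of the sums that is
   uniform in [N]. *)
pose g (t : T) : R := `|Y t| * dl^-1 + 1.
have g_int : mu.-integrable setT (EFin \o g).
  apply: integrableD_real => //; last exact: integrable_cst_real.
  rewrite (_ : (fun _ => _) = fun t => dl^-1 * `|Y t|).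
    by apply: integrableZ_real => //; exact: integrable_norm.
  by apply/funext => t; rewrite mulrC.
have bound N t : `|shift_sum b (K t) N| <= g t.
  have [/(_ N) bd _] := spec t; apply: (le_trans bd).
  have h1 := KL t; have h2 := KU t.
  have := ler_norm (Y t / dl); have := lerNnormlW (lexx `|Y t / dl|).
  rewrite normrM (gtr0_norm (_ : 0 < dl^-1)) ?invr_gt0// -/(g t) => h3 h4.
  by rewrite /g ler_norml; apply/andP; split; lra.
have cvI := @Rdominated_convergence _ _ _ mu discr
  (fun N t => shift_sum b (K t) N) L g g_int bound cL.
(* At the positive grid points harmonicity says that the unrounded shift by [Y] averages to zero;
   rounding [Y] up can only increase the sum, as [q] is nondecreasing. *)
have I_ge0 N : 0 <= \int[mu]_t shift_sum b (K t) N.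
  pose F (i : 'I_N) (t : T) : R := q (i.+1%:~R * dl + Y t) - q (i.+1%:~R * dl).
  have F_int i : mu.-integrable setT (EFin \o F i).
    apply: (bounded_integrable_real mu discr (r := 1)) => t.
    have := q_ge0 (i.+1%:~R * dl + Y t); have := q_ge0 (i.+1%:~R * dl).
    have := q_le1 (i.+1%:~R * dl + Y t); have := q_le1 (i.+1%:~R * dl).
    by rewrite /F ler_norml => *; apply/andP; split; lra.
  have [S_int S_sum] := Rintegral_sum discr (index_enum 'I_N) F_int.
  have -> : 0 = \int[mu]_t \sum_(i < N) F i t.
    rewrite S_sum big1// => i _; rewrite /F RintegralB//.
    - have -> : \int[mu]_t q (i.+1%:~R * dl + Y t) = q (i.+1%:~R * dl).
        by apply/esym/q_harmonic; rewrite mulr_gt0// ltr0z.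
      by rewrite Rintegral_prob_cst; exact: subrr.
    - by apply: (bounded_integrable_real mu discr (r := 1)) => t; rewrite ger0_norm.
    - exact: integrable_cst_real.
  apply: le_Rintegral => //.
    by apply: (dominated_integrable_real discr g_int).
  move=> t _; apply: ler_sum => i _; rewrite /F lerB// /b; apply: q_nd.
  by rewrite intrD mulrDl lerD2l -ler_pdivrMr.
have L_ge0 : 0 <= \int[mu]_t L t.
  exact: (cvg_ge_cst cvI).
have L_int : mu.-integrable setT (EFin \o L).
  apply: (dominated_integrable_real discr g_int) => t.
  rewrite ler_norml; apply/andP; split.
    by apply: (cvg_ge_cst (cL t)) => N; have := bound N t; rewrite ler_norml => /andP[].
  by apply: (cvg_le_cst (cL t)) => N; have := bound N t; rewrite ler_norml => /andP[].
have i1 : mu.-integrable setT (EFin \o (fun t => (s / dl) * Y t + s)).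
  by apply: integrableD_real => //; [exact: integrableZ_real|exact: integrable_cst_real].
have i2 : mu.-integrable setT (EFin \o (fun t => (q e / dl) * excess e t)).
  exact: integrableZ_real.
have : \int[mu]_t L t <= \int[mu]_t ((s / dl) * Y t + s - (q e / dl) * excess e t).
  apply: le_Rintegral => //.
    exact: integrableB_real.
  by move=> t _; apply: (le_trans (leL t)); rewrite le_eqVlt; apply/orP; left; apply/eqP; ring.
move/(le_trans L_ge0).
rewrite RintegralB// RintegralD//; last 2 first.
- exact: integrableZ_real.
- exact: integrable_cst_real.
rewrite !RintegralZl// Rintegral_prob_cst.
rewrite subr_ge0 mulrAC ler_pdivrMr// => h.
exists s; rewrite s0 s1; split=> // [n|].
  apply: (@cvg_ge_cst _ (fun m => b (n + m)%:Z)).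
    rewrite (_ : (fun _ => _) = fun m => b (m + n)%:Z).
      by rewrite (cvg_shiftn n (fun m : nat => b m)).
    by apply/funext => m; rewrite addnC.
  by move=> m; rewrite (@b_nd n%:Z)// lez_nat leq_addr.
apply: (le_trans h); rewrite le_eqVlt; apply/orP; left; apply/eqP.
by field; rewrite gt_eqF.
Qed.

Lemma harmonic_eq0 x : q x = 0.
Proof.
(* By monotonicity it suffices that [q] vanishes on an unbounded grid. *)
have grid dl : 0 < dl -> (forall n : nat, q (n.+1%:R * dl) = 0) -> q x = 0.
  move=> dl0 qn; have [n] : exists n : nat, x <= n.+1%:R * dl.
    by exists (Num.trunc (x / dl)); rewrite -ler_pdivrMr// ltW// truncnS_gt.
  by move=> /q_nd; rewrite qn => h; apply/eqP; rewrite eq_le h q_ge0.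
have excess_ge0 e : 0 <= \int[mu]_t excess e t.
  by apply: Rintegral_ge0 => t _; rewrite /excess le_max lexx.
have [drift_lt0|drift_ge0] := ltP (\int[mu]_t Y t) 0.
  (* With this [dl] the factor [E Y + dl] equals [E Y / 2], still negative, which forces
     [s <= 0]. *)
  have dl0 : 0 < - (\int[mu]_t Y t) / 2 by rewrite divr_gt0// oppr_gt0.
  have [s [/andP[s0 _] qs qI]] := harmonic_drift_le ltr01 dl0.
  have : 0 <= s * (\int[mu]_t Y t / 2).
    apply: (le_trans (mulr_ge0 (q_ge0 1) (excess_ge0 1))); apply: (le_trans qI).
    by rewrite le_eqVlt; apply/orP; left; apply/eqP; field.
  have I2 : (\int[mu]_t Y t) / 2 < 0 by lra.
  rewrite (nmulr_lge0 _ I2) => s_le0; apply: (grid _ dl0) => n.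
  by apply/eqP; rewrite eq_le q_ge0 andbT (le_trans (qs _)).
have drift0 : \int[mu]_t Y t = 0 by apply/eqP; rewrite eq_le Y_drift.
(* With zero drift and [s <= 1], the product is at most [dl], which is arbitrarily small. *)
have excess_prod e : 0 < e -> q e * \int[mu]_t excess e t = 0.
  move=> e0; apply/eqP; rewrite eq_le; apply/andP; split.
    apply/ler_addgt0Pl => dl dl0; rewrite addr0.
    have [s [/andP[_ s1] _ h]] := harmonic_drift_le e0 dl0.
    by rewrite (le_trans h)// drift0 add0r ler_piMl// ltW.
  by rewrite mulr_ge0.
(* The absolute value of [Y] is twice its positive part minus [Y], and [Y] has mean zero. *)
have excess0 : 0 < \int[mu]_t excess 0 t.
  have : \int[mu]_t `|Y t| = \int[mu]_t (2 * excess 0 t - Y t).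
    apply: eq_Rintegral => t _; rewrite /excess subr0.
    have [Y0|/ltW Y0] := leP 0 (Y t).
      by rewrite ger0_norm//; ring.
    by rewrite ler0_norm//; ring.
  rewrite RintegralB// ?RintegralZl//; last exact: integrableZ_real.
  by move=> E; move: Y_nonzero; rewrite E drift0; lra.
(* Raising the threshold from 0 to [e] costs at most [e] in the mean excess, so half of that mean
   survives. *)
pose e := \int[mu]_t excess 0 t / 2.
have e0 : 0 < e by rewrite divr_gt0.
have excess_e : 0 < \int[mu]_t excess e t.
  have : \int[mu]_t excess 0 t <= \int[mu]_t (excess e t + e).
    apply: le_Rintegral => //.
      by apply: integrableD_real => //; exact: integrable_cst_real.
    move=> t _; rewrite /excess subr0 ge_max.
    have h1 : 0 <= Num.max 0 (Y t - e) by rewrite le_max lexx.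
    have h2 : Y t - e <= Num.max 0 (Y t - e) by rewrite le_max lexx orbT.
    by apply/andP; split; lra.
  rewrite RintegralD// ?Rintegral_prob_cst; last exact: integrable_cst_real.
  by rewrite {2}/e; lra.
have qe : q e = 0.
  by have /eqP := excess_prod e e0; rewrite mulf_eq0 (gt_eqF excess_e) orbF => /eqP.
(* Harmonicity and monotonicity give [q y >= q (y + e) * mu A], and [A] is not null: otherwise the
   excess over [e] would vanish almost everywhere. *)
have step y : 0 < y -> q y = 0 -> q (y + e) = 0.
  move=> y0 qy; pose A := [set t | e < Y t].
  have : q (y + e) * \int[mu]_t \1_A t <= 0.
    rewrite -RintegralZl//; last first.
      apply: (bounded_integrable_real mu discr (r := 1)) => t.
      by rewrite indicE; case: (_ \in _); rewrite ?normr0 ?normr1.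
    rewrite -[leRHS]qy (q_harmonic y0); apply: le_Rintegral => //.
    - apply: (bounded_integrable_real mu discr (r := 1)) => t.
      rewrite ger0_norm ?mulr_ge0// indicE.
      by case: (_ \in _); rewrite ?mulr0 ?mulr1.
    - by apply: (bounded_integrable_real mu discr (r := 1)) => t; rewrite ger0_norm.
    move=> t _; rewrite indicE; have [|] := boolP (t \in A); last by rewrite mulr0.
    by rewrite inE mulr1 /A/= => eY; apply: q_nd; rewrite lerD2l ltW.
  have A0 : 0 < \int[mu]_t \1_A t.
    rewrite lt_neqAle Rintegral_ge0// andbT; apply/eqP => A0.
    have mA : mu A = 0%E.
      apply/eqP; rewrite -fine_eq0 ?fin_num_measure//.
      by rewrite /Rintegral integral_indic// setIT in A0; rewrite -A0.
    have : \int[mu]_t excess e t = 0.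
      rewrite /Rintegral (ae_eq_integral (cst 0%E))//.
      - by rewrite integral0.
      - exists A; split=> // t /= /not_implyP[_] h; rewrite /A/= ltNge.
        by apply/negP => Ye; apply: h; rewrite /excess max_l// subr_le0.
    by move=> h; rewrite h ltxx in excess_e.
  by rewrite pmulr_lle0// => h; apply/eqP; rewrite eq_le h q_ge0.
have qn n : q (n.+1%:R * e) = 0.
  elim: n => [|n IH]; first by rewrite mul1r.
  by rewrite -addn1 natrD mulrDl mul1r step// mulr_gt0.
exact: (grid _ e0).
Qed.

End HarmonicFunctions.

(** * Probabilities that the walk stays positive up to a finite time *)

Section Survival.
Context d (T : measurableType d) (R : realType) (mu : probability T R).
Variable Y : T -> R.

(** The probability that the walk started at [x], with independent steps distributed as [Y], is
    positive at the times 0 to [n - 1]; its position at time [n] is not tested. *)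
Fixpoint survival (n : nat) (x : R) : R :=
  if n is m.+1 then (if 0 < x then \int[mu]_t survival m (x + Y t) else 0)
  else 1.

Lemma survivalE n x :
  survival n.+1 x = if 0 < x then \int[mu]_t survival n (x + Y t) else 0.
Proof. by []. Qed.

Hypothesis discr : forall A : set T, measurable A.
Hypothesis Y_int : mu.-integrable setT (EFin \o Y).
Hypothesis Y_drift : \int[mu]_t Y t <= 0.
Hypothesis Y_nonzero : 0 < \int[mu]_t `|Y t|.

Lemma survival_itv n x : 0 <= survival n x <= 1.
Proof.
elim: n x => [|n IH] x /=; first by rewrite ler01 lexx.
case: ifP => _; last by rewrite lexx ler01.
apply/andP; split; first by apply: Rintegral_ge0 => t _; have /andP[] := IH (x + Y t).
rewrite -(Rintegral_prob_cst mu 1); apply: le_Rintegral => //.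
- apply: (bounded_integrable_real mu discr (r := 1)) => t.
  by have /andP[? ?] := IH (x + Y t); rewrite ger0_norm.
- exact: integrable_cst_real.
- by move=> t _; have /andP[] := IH (x + Y t).
Qed.

Lemma survival_int n x : mu.-integrable setT (EFin \o (fun t => survival n (x + Y t))).
Proof.
apply: (bounded_integrable_real mu discr (r := 1)) => t.
by have /andP[? ?] := survival_itv n (x + Y t); rewrite ger0_norm.
Qed.

Lemma survival_nd n x y : x <= y -> survival n x <= survival n y.
Proof.
elim: n x y => [|n IH] x y xy //=.
case: ifP => x0; case: ifP => y0 //.
- apply: le_Rintegral => //; [exact: survival_int|exact: survival_int|].
  by move=> t _; apply: IH; rewrite lerD2r.
- by rewrite (lt_le_trans x0 xy) in y0.
- by apply: Rintegral_ge0 => t _; have /andP[] := survival_itv n (y + Y t).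
Qed.

Lemma survivalS n x : survival n.+1 x <= survival n x.
Proof.
elim: n x => [|n IH] x; first by have /andP[] := survival_itv 1 x.
rewrite (survivalE n.+1 x) (survivalE n x); case: ifP => // _.
by apply: le_Rintegral => //; exact: survival_int.
Qed.

(** The decreasing limit in [n] inherits monotonicity, vanishes at nonpositive points and is
    harmonic at positive ones by dominated convergence, so [harmonic_eq0] applies to it. *)
Lemma survival_cvg0 x : survival ^~ x @ \oo --> 0.
Proof.
pose q y := inf (range (survival ^~ y)).
have lb y : has_lbound (range (survival ^~ y)).
  by exists 0 => _ [n _ <-]; have /andP[] := survival_itv n y.
have cq y : survival ^~ y @ \oo --> q y.
  have ni : {homo survival ^~ y : n m / (n <= m)%N >-> m <= n}.
    by apply/nonincreasing_seqP => n; exact: survivalS.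
  exact: (nonincreasing_cvgn ni (lb y)).
have qle y n : q y <= survival n y by apply: ge_inf => //; exists n.
have q0 y : 0 <= q y.
  by apply: (cvg_ge_cst (cq y)) => n; have /andP[] := survival_itv n y.
suff <- : q x = 0 by [].
apply: (@harmonic_eq0 _ _ _ mu discr Y) => //.
- move=> y z yz; apply: (cvg_ge_cst (cq z)) => n.
  exact: le_trans (survival_nd n yz).
- by move=> y; apply: (le_trans (qle y 0%N)).
- move=> y y0; apply/eqP; rewrite eq_le q0 andbT (le_trans (qle y 1%N))//=.
  by rewrite ltNge y0.
- move=> y y0.
  have c1 : (fun n => survival n.+1 y) @ \oo --> q y.
    by rewrite (cvg_shiftS (survival ^~ y)).
  have c2 : (fun n => survival n.+1 y) @ \oo --> \int[mu]_t q (y + Y t).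
    rewrite (_ : (fun _ => _) = fun n => \int[mu]_t survival n (y + Y t)); last first.
      by apply/funext => n; rewrite survivalE y0.
    have bd n t : `|survival n (y + Y t)| <= 1.
      by have /andP[? ?] := survival_itv n (y + Y t); rewrite ger0_norm.
    exact: (Rdominated_convergence discr (integrable_cst_real mu discr 1) bd
      (fun t => cq (y + Y t))).
  by rewrite -(cvg_lim _ c1)// (cvg_lim _ c2).
Qed.

End Survival.

(** * Sums, measures and integrals indexed by a countable type *)

Section CountableSums.
Local Open Scope ereal_scope.
Context (R : realType).

Lemma esumZl (I : choiceType) (D : set I) (r : R) (a : I -> \bar R) :
  (0 <= r)%R -> (forall i, 0 <= a i) ->
  \esum_(i in D) (r%:E * a i) = r%:E * \esum_(i in D) a i.
Proof.
move=> r0 a0; rewrite /esum -ereal_supZl//; last first.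
  by apply/set0P; exists (\sum_(x \in set0) a x); exists set0 => //; exact: fsets_set0.
congr ereal_sup; apply/seteqP; split=> [_ [A [finA AD] <-]|_ [_ [A [finA AD] <-] <-]].
  exists (\sum_(x \in A) a x); first by exists A.
  by rewrite ge0_mule_fsumr.
by exists A => //; rewrite ge0_mule_fsumr.
Qed.

(** Turns a family over a countable type into a sequence, with the default [b] at the numbers that
    code no index, so that statements about sequences apply. *)
Definition pick_index (I : countType) (n : nat) (B : Type) (b : B) (F : I -> B) : B :=
  if pickle_inv n is Some i then F i else b.

Lemma nneseries_pickle (I : countType) (a : I -> \bar R) : (forall i, 0 <= a i) ->
  \sum_(n <oo) pick_index n 0 a = \esum_(i in [set: I]) a i.
Proof.
move=> a0; rewrite nneseries_esumT; last first.
  by move=> n; rewrite /pick_index; case: pickle_inv.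
rewrite (esumID (range (@pickle I))); last first.
  by move=> n _; rewrite /pick_index; case: pickle_inv.
rewrite [X in _ + X]esum1 ?adde0; last first.
  move=> n [_ nI]; rewrite /pick_index; case E : (pickle_inv n) => [i|//].
  by exfalso; apply: nI; exists i => //; have := @pickle_invK I n; rewrite /oapp/= E.
rewrite setTI esum_image; last by move=> i j _ _; exact: (pcan_inj (@pickleK_inv I)).
by apply: eq_esum => i _; rewrite /pick_index pickleK_inv.
Qed.

Lemma trivIset_pick_index (I : countType) (T : Type) (F : I -> set T) :
  trivIset setT F -> trivIset setT (fun n => pick_index n set0 F).
Proof.
move=> tF; apply/trivIsetP => m n _ _ mn; rewrite /pick_index.
case Em : (pickle_inv m) => [i|]; last by rewrite set0I.
case En : (pickle_inv n) => [j|]; last by rewrite setI0.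
move/trivIsetP : tF; apply => //; apply/eqP => ij; move/eqP : mn; apply.
by have := @pickle_invK I m; have := @pickle_invK I n; rewrite /oapp Em En ij => <- <-.
Qed.

Lemma bigcup_pick_index (I : countType) (T : Type) (F : I -> set T) :
  \bigcup_n pick_index n set0 F = \bigcup_i F i.
Proof.
rewrite /pick_index; apply/seteqP; split=> [t [n _]|t [i _ Fit]].
  by case: (pickle_inv n) => [i Fit|//]; exists i.
by exists (pickle i) => //; rewrite pickleK_inv.
Qed.

Lemma measure_bigcup_esum d (T : measurableType d) (I : countType)
    (mu : {measure set T -> \bar R}) (F : I -> set T) :
  (forall i, measurable (F i)) -> trivIset setT F ->
  mu (\bigcup_i F i) = \esum_(i in [set: I]) mu (F i).
Proof.
move=> mF tF; rewrite -bigcup_pick_index measure_bigcup//; last 2 first.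
- by move=> n _; rewrite /pick_index; case: pickle_inv.
- exact: trivIset_pick_index.
rewrite -nneseries_pickle//.
rewrite (@eq_eseriesl _ _ xpredT); last by move=> n; rewrite in_setT.
by apply: eq_eseriesr => n _; rewrite /pick_index; case: pickle_inv.
Qed.

(** The fibres of [X] cut the space into countably many pieces on which the integrand is
    constant. *)
Lemma ge0_integral_esum d (T : measurableType d) (I : countType)
    (mu : {measure set T -> \bar R}) (X : T -> I) (f : I -> \bar R) :
  (forall i, measurable (X @^-1` [set i])) -> (forall i, 0 <= f i) ->
  \int[mu]_t f (X t) = \esum_(i in [set: I]) (f i * mu (X @^-1` [set i])).
Proof.
move=> mX f0.
have XT : \bigcup_i (X @^-1` [set i]) = setT.
  by apply/seteqP; split=> // t _; exists (X t).
have tX : trivIset setT (fun i => X @^-1` [set i]).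
  by apply/trivIsetP => i j _ _ ij; apply/seteqP; split=> // t [/= ->] /eqP; rewrite (negbTE ij).
have mpick n : measurable (pick_index n set0 (fun i => X @^-1` [set i])).
  by rewrite /pick_index; case: pickle_inv.
(* A preimage under [f \o X] is a countable union of fibres of [X]. *)
have mf : measurable_fun setT (f \o X).
  move=> _ B mB; rewrite setTI.
  rewrite (_ : _ @^-1` B = \bigcup_n
    (if pick_index n false (fun i => f i \in B)
     then pick_index n set0 (fun i => X @^-1` [set i]) else set0)).
    by apply: bigcup_measurable => n _; case: ifP.
  apply/seteqP; split=> [t Bt|t [n _]].
    by exists (pickle (X t)) => //; rewrite /pick_index pickleK_inv mem_set.
  rewrite /pick_index; case: (pickle_inv n) => // i.
  by case: ifP => // /set_mem Bi Xti; rewrite /preimage/= Xti.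
rewrite -XT -bigcup_pick_index ge0_integral_bigcup//; last 2 first.
- by rewrite bigcup_pick_index XT.
- exact: trivIset_pick_index.
rewrite -nneseries_pickle; last by move=> i; rewrite mule_ge0.
apply: eq_eseriesr => n _; rewrite /pick_index; case: pickle_inv => [i|]; last first.
  by rewrite integral_set0.
rewrite (eq_integral (fun=> f i)); last by move=> t; rewrite inE => /= ->.
by rewrite integral_cst.
Qed.

End CountableSums.

(** * Exchange of sums and finite products *)

Section ProductSums.
Local Open Scope ereal_scope.

(** Distributivity by induction on the dimension: the first coordinate is split off, and finiteness
    of the sums lets each factor be pulled out as a real scalar. *)
Lemma esum_prod_col (R : realType) (n : nat) (f : 'I_n -> int -> \bar R) :
  (forall k z, 0 <= f k z) -> (forall k, \esum_(z in [set: int]) f k z \is a fin_num) ->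
  \esum_(u in [set: 'cV[int]_n]) \prod_(k < n) f k (u k ord0) =
  \prod_(k < n) \esum_(z in [set: int]) f k z.
Proof.
elim: n f => [|n IH] f f0 ffin.
  rewrite big_ord0 (_ : [set: _] = [set 0%R]).
    by rewrite esum_set1 big_ord0.
  by apply/seteqP; split=> // u _; apply/matrixP => -[].
(* Puts the entry [z] on top of the column [u]; this bijection reindexes the sum as a double sum. *)
pose e (zu : int * 'cV[int]_n) : 'cV[int]_n.+1 :=
  (\col_i (if unlift ord0 i is Some j then zu.2 j ord0 else zu.1))%R.
have eB : set_bij ([set: int] `*`` (fun=> [set: 'cV[int]_n])) [set: 'cV[int]_n.+1] e.
  split=> //.
  - move=> [z u] [z' u'] _ _ E; congr pair.
      by move/matrixP : E => /(_ ord0 ord0); rewrite !mxE unlift_none.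
    apply/colP => i.
    by move/matrixP : E => /(_ (lift ord0 i) ord0); rewrite !mxE liftK.
  - move=> u _; exists (u ord0 ord0, \col_i u (lift ord0 i) ord0)%R => //.
    apply/colP => i; rewrite !mxE.
    by case: unliftP => [k ->|->] /=; rewrite ?mxE.
rewrite (reindex_esum _ _ _ _ eB).
transitivity (\esum_(z in [set: int]) \esum_(u in [set: 'cV[int]_n])
    (f ord0 z * \prod_(k < n) f (lift ord0 k) (u k ord0))).
  rewrite esum_esum; last by move=> z u _ _; rewrite mule_ge0// prode_ge0.
  apply: eq_esum => zu _; rewrite big_ord_recl mxE unlift_none; congr (_ * _).
  by apply: eq_bigr => k _; rewrite mxE liftK.
have f0fin z : f ord0 z \is a fin_num.
  rewrite ge0_fin_numE// -(gee0_abs (f0 ord0 z)).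
  apply: (@summable_pinfty _ _ setT (f ord0)) => //; rewrite /summable.
  under eq_esum do rewrite gee0_abs//.
  by rewrite -ge0_fin_numE// esum_ge0.
have Sfin k : 0 <= \esum_(z in [set: int]) f k z by exact: esum_ge0.
rewrite big_ord_recl.
under eq_esum => z _.
  rewrite -(fineK (f0fin z)) esumZl ?fine_ge0//; last by move=> u; exact: prode_ge0.
  rewrite fineK// (IH (fun k => f (lift ord0 k)))//.
  over.
have Pfin : (\prod_(k < n) \esum_(z in [set: int]) f (lift ord0 k) z) \is a fin_num.
  exact: prode_fin_num.
rewrite -(fineK Pfin) muleC -esumZl ?fine_ge0 ?prode_ge0//.
by apply: eq_esum => z _; rewrite muleC.
Qed.

End ProductSums.

(* An alias, so that the discrete sigma-algebra does not interfere with the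
   structures already attached to matrices. *)
Definition sample_space (n : nat) := 'cV[int]_n.

HB.instance Definition _ n := Countable.on (sample_space n).
HB.instance Definition _ n := isPointed.Build (sample_space n) 0.
HB.instance Definition _ n := @isMeasurable.Build default_measure_display
  (sample_space n) (@discrete_measurable (sample_space n))
  (@discrete_measurable0 (sample_space n))
  (@discrete_measurableC (sample_space n)) (@discrete_measurableU (sample_space n)).

(** * The product law of the sampling variables and its marginals *)

Section JointLaw.
Local Open Scope ereal_scope.
Context (R : realType) (nX nR : nat) (P : incremental_loop R nX nR).

Lemma joint_pmf_ge0 u : 0 <= joint_pmf P u.
Proof. by apply: prode_ge0. Qed.

(** The product measure is given by its point masses, so that the transition probabilities under a
    true guard are values of it by definition. *)
Definition joint_law (A : set (sample_space nR)) : \bar R :=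
  \esum_(u in A) joint_pmf P u.

Let joint_law0 : joint_law set0 = 0. Proof. exact: esum_set0. Qed.

Let joint_law_ge0 A : 0 <= joint_law A.
Proof. by apply: esum_ge0 => u _; exact: joint_pmf_ge0. Qed.

Let joint_law_sigma_additive : semi_sigma_additive joint_law.
Proof.
move=> F mF tF _; rewrite /joint_law nneseries_sum_bigcup//; last first.
  exact: joint_pmf_ge0.
by apply: is_cvg_nneseries => n _ _; exact: joint_law_ge0.
Qed.

HB.instance Definition _ := isMeasure.Build _ _ _ joint_law
  joint_law0 joint_law_ge0 joint_law_sigma_additive.

Lemma sampling_esum k (B : set int) :
  \esum_(z in [set: int]) (sampling P k [set z] * (\1_B z)%:E) = sampling P k B.
Proof.
transitivity (\int[sampling P k]_z (\1_B z)%:E); last by rewrite integral_indic// setIT.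
rewrite (@ge0_integral_esum R _ int int (sampling P k) (fun z => z) (fun z => (\1_B z)%:E))//.
by apply: eq_esum => z _; rewrite muleC.
Qed.

Lemma joint_law_marginal k (B : set int) :
  joint_law [set u | B (u k ord0)] = sampling P k B.
Proof.
(* The indicator of [B] is absorbed into the factor [k]; every other factor sums to 1. *)
pose f (j : 'I_nR) (z : int) : \bar R :=
  sampling P j [set z] * (\1_(if j == k then B else setT) z)%:E.
have fS j : \esum_(z in [set: int]) f j z = sampling P j (if j == k then B else setT).
  exact: sampling_esum.
have := @esum_prod_col R nR f.
under eq_bigr do rewrite fS.
rewrite (bigD1 k)//= eqxx big1 ?mule1; last first.
  by move=> j /negbTE ->; exact: probability_setT.
move=> <-.
- rewrite /joint_law esum_mkcond; apply: eq_esum => u _.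
  rewrite /f (bigD1 k)//= eqxx.
  case: ifPn => [/set_mem uB|/negP uB].
    rewrite /joint_pmf (bigD1 k)//= indicE mem_set// mule1; congr (_ * _).
    by apply: eq_bigr => j /negbTE ->; rewrite indicT mule1.
  by rewrite indicE memNset ?mule0 ?mul0e// => h; apply: uB; exact: mem_set.
- by move=> j z; rewrite mule_ge0// lee_fin.
- by move=> j; rewrite fS fin_num_measure.
Qed.

End JointLaw.

(** * Expectations of coordinates under the joint law *)

Section JointLawMoments.
Local Open Scope ereal_scope.
Context (R : realType) (nX nR : nat) (P : incremental_loop R nX nR).

Lemma joint_law_setT : joint_law P setT = 1.
Proof.
rewrite /joint_law; have sumT k : \esum_(z in [set: int]) sampling P k [set z] = 1.
  rewrite -(probability_setT (sampling P k)) -sampling_esum.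
  by apply: eq_esum => z _; rewrite indicT mule1.
rewrite (@esum_prod_col R nR (fun k z => sampling P k [set z]))//.
  by rewrite big1.
by move=> k; rewrite sumT.
Qed.

HB.instance Definition _ :=
  Measure_isProbability.Build _ _ _ (joint_law P) joint_law_setT.

Lemma joint_law_set1 u : joint_law P [set u] = joint_pmf P u.
Proof. by rewrite /joint_law esum_set1// joint_pmf_ge0. Qed.

Lemma integral_joint_law (g : 'cV[int]_nR -> \bar R) : (forall u, 0 <= g u) ->
  \int[joint_law P]_u g u = \esum_(u in [set: 'cV[int]_nR]) (joint_pmf P u * g u).
Proof.
move=> g0.
rewrite (@ge0_integral_esum R _ (sample_space nR) (sample_space nR) (joint_law P) (fun u => u) g)//.
by apply: eq_esum => u _; rewrite muleC -joint_law_set1.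
Qed.

Lemma ge0_integral_coord k (g : int -> \bar R) : (forall z, 0 <= g z) ->
  \int[joint_law P]_u g (u k ord0) = \int[sampling P k]_z g z.
Proof.
move=> g0.
rewrite (@ge0_integral_esum R _ (sample_space nR) int (joint_law P) (fun u => u k ord0) g)//.
rewrite (@ge0_integral_esum R _ int int (sampling P k) (fun z => z) g)//.
by apply: eq_esum => z _; congr (_ * _); exact: (joint_law_marginal P k [set z]).
Qed.

Lemma integral_coord k (g : int -> \bar R) :
  \int[joint_law P]_u g (u k ord0) = \int[sampling P k]_z g z.
Proof.
rewrite [LHS]integralE [RHS]integralE; congr (_ - _).
  rewrite -(ge0_integral_coord k (funepos_ge0 g)).
  by apply: eq_integral => u _; rewrite !funeposE.
rewrite -(ge0_integral_coord k (funeneg_ge0 g)).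
by apply: eq_integral => u _; rewrite !funenegE.
Qed.

Hypothesis fin_var : finite_variance P.

Lemma sampling_integrable k : (sampling P k).-integrable setT (EFin \o intr).
Proof.
apply/Lfun1_integrable; apply: Lfun_subset12; last exact: fin_var.
exact: fin_num_measure.
Qed.

Lemma coord_integrable k :
  (joint_law P).-integrable setT (EFin \o (fun u : 'cV[int]_nR => (u k ord0)%:~R : R)).
Proof.
have /integrableP[_ fin] := sampling_integrable k.
apply/integrableP; split=> //.
by rewrite (integral_coord k (fun z => `|((z%:~R : R)%:E)|)).
Qed.

Lemma Rintegral_coord k :
  (\int[joint_law P]_u ((u : 'cV[int]_nR) k ord0)%:~R)%R = mean P k.
Proof.
rewrite /mean unlock /Rintegral.
by rewrite (integral_coord k (fun z => (z%:~R : R)%:E)).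
Qed.

End JointLawMoments.

(** * The increment of the progress function: mean and nondegeneracy *)

Section Increment.
Local Open Scope ereal_scope.
Context (R : realType) (nX nR : nat) (P : incremental_loop R nX nR).

(** If [c] carried all the mass, every integral would be the value of its integrand at [c], and the
    variance would be zero. *)
Lemma sampling_nondegenerate k (c : int) : (0 < var P k)%R ->
  exists2 z, z <> c & 0 < sampling P k [set z].
Proof.
move=> vpos; apply: contrapT => noz.
have z0 z : z <> c -> sampling P k [set z] = 0.
  move=> zc; apply/eqP; rewrite eq_le measure_ge0 andbT leNgt.
  by apply/negP => zpos; apply: noz; exists z.
have neg0 : sampling P k (~` [set c]) = 0.
  rewrite -sampling_esum esum1// => z _; rewrite indicE.
  by have [/set_mem/= zc|_] := boolP (z \in _); [rewrite z0// mul0e|rewrite mule0].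
have ae_c (f : int -> \bar R) : \int[sampling P k]_z f z = f c.
  rewrite (ae_eq_integral (cst (f c)))//.
    by rewrite integral_cst// [X in _ * X]probability_setT mule1.
  exists (~` [set c]); split=> // z /= /not_implyP[_] h zc.
  by apply: h; rewrite zc.
move: vpos; rewrite /var /variance unlock /= unlock ae_c /= ae_c/=.
by rewrite [X in (0 < X)%R](_ : _ = (c%:~R - c%:~R) * (c%:~R - c%:~R))%R// subrr mulr0 ltxx.
Qed.

Lemma joint_pmf_gt0 u :
  (0 < joint_pmf P u) <-> forall k, 0 < sampling P k [set u k ord0].
Proof.
have fP k : sampling P k [set u k ord0] = (fine (sampling P k [set u k ord0]))%:E.
  by rewrite fineK// fin_num_measure.
rewrite /joint_pmf; under eq_bigr do rewrite fP.
rewrite prodEFin lte_fin; split=> [pos k|pos].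
  rewrite lt_neqAle measure_ge0 andbT; apply/eqP => k0.
  by move: pos; rewrite (bigD1 k)//= -k0 mul0r ltxx.
by apply: prodr_gt0 => k _; rewrite -lte_fin -fP.
Qed.

Variable alpha : 'I_nR -> R.

Definition increment (u : sample_space nR) : R :=
  (\sum_(k < nR) alpha k * (u k ord0)%:~R)%R.

(** Start from any atom [u0]. If the increment vanishes there, moving the coordinate [k] to another
    atom of its distribution changes the increment by a nonzero multiple of [alpha k]. *)
Lemma increment_nondegenerate k : alpha k != 0%R -> (0 < var P k)%R ->
  exists2 u, 0 < joint_pmf P u & increment u != 0%R.
Proof.
move=> ak vk.
have [u0 u0pos] : exists u, 0 < joint_pmf P u.
  apply: contrapT => nopos; have := joint_law_setT P.
  rewrite /joint_law esum1.
    by move=> /eqP; rewrite eq_sym onee_eq0.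
  move=> u _; apply/eqP; rewrite eq_le joint_pmf_ge0 andbT leNgt.
  by apply/negP => upos; apply: nopos; exists u.
have [z zu zpos] := sampling_nondegenerate (u0 k ord0) vk.
have [Y0|] := eqVneq (increment u0) 0%R; last by exists u0.
pose u1 : 'cV[int]_nR := (\col_i (if i == k then z else u0 i ord0))%R.
exists u1.
  apply/joint_pmf_gt0 => j; rewrite mxE; case: eqP => [->//|_].
  exact: (joint_pmf_gt0 u0).1.
have -> : increment u1 = (increment u0 + alpha k * (z%:~R - (u0 k ord0)%:~R))%R.
  rewrite /increment (bigD1 k)//= [in RHS](bigD1 k)//= mxE eqxx.
  rewrite (eq_bigr (fun j => alpha j * (u0 j ord0)%:~R)%R); first by ring.
  by move=> j /negbTE jk; rewrite mxE jk.
by rewrite Y0 add0r mulf_neq0// subr_eq0 eqr_int; apply/eqP.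
Qed.

Hypothesis fin_var : finite_variance P.

Lemma increment_integrable : (joint_law P).-integrable setT (EFin \o increment).
Proof.
have F_int k : (joint_law P).-integrable setT
    (EFin \o (fun u : sample_space nR => alpha k * (u k ord0)%:~R))%R.
  by apply: integrableZ_real; exact: coord_integrable.
by have [] := @Rintegral_sum _ _ _ (joint_law P) (fun _ => I) _ (index_enum 'I_nR) _ F_int.
Qed.

Lemma Rintegral_increment :
  (\int[joint_law P]_u increment u = \sum_(k < nR) alpha k * mean P k)%R.
Proof.
have F_int k : (joint_law P).-integrable setT
    (EFin \o (fun u : sample_space nR => alpha k * (u k ord0)%:~R))%R.
  by apply: integrableZ_real; exact: coord_integrable.
have [_ ->] := @Rintegral_sum _ _ _ (joint_law P) (fun _ => I) _ (index_enum 'I_nR) _ F_int.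
apply: eq_bigr => k _; rewrite -(Rintegral_coord P k) -RintegralZl//.
exact: coord_integrable.
Qed.

Lemma Rintegral_norm_increment_gt0 :
  (0 < \sum_(k < nR) alpha k ^+ 2 * var P k)%R ->
  (0 < \int[joint_law P]_u `|increment u|)%R.
Proof.
move=> pos.
have [k ak vk] : exists2 k, alpha k != 0%R & (0 < var P k)%R.
  apply: contrapT => nok; move: pos; rewrite big1 ?ltxx// => k _.
  have [->|ak] := eqVneq (alpha k) 0%R; first by rewrite expr0n mul0r.
  have : (0 <= var P k)%R by apply: fine_ge0; exact: variance_ge0.
  rewrite le_eqVlt => /orP[/eqP <-|vk]; first by rewrite mulr0.
  by exfalso; apply: nok; exists k.
have [u upos Yu] := increment_nondegenerate ak vk.
(* Finiteness matters: [Rintegral] goes through [fine], which sends an infinite integral to 0. *)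
have Yfin : \int[joint_law P]_u `|increment u|%:E \is a fin_num.
  apply: integrable_fin_num => //.
  exact: (integrable_norm increment_integrable).
rewrite -lte_fin /Rintegral fineK// integral_joint_law//.
(* The contribution of the single atom [u] is already positive. *)
apply: (@lt_le_trans _ _ (joint_pmf P u * `|increment u|%:E)).
  by rewrite mule_gt0// lte_fin normr_gt0.
rewrite (esumID [set u])//; last by move=> v _; rewrite mule_ge0// joint_pmf_ge0.
rewrite setTI esum_set1 ?mule_ge0 ?joint_pmf_ge0// leeDl//.
by apply: esum_ge0 => v _; rewrite mule_ge0// joint_pmf_ge0.
Qed.

End Increment.

(** * Comparison of the loop with the walk of its progress function *)

Section LoopChain.
Local Open Scope ereal_scope.
Context (R : realType) (nX nR : nat) (P : incremental_loop R nX nR).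
Variables (a : 'cV[R]_nX) (c : R).
Let h (v : 'cV[int]_nX) : R := ((a^T *m map_mx intr v) ord0 ord0 + c)%R.
Let alpha (k : 'I_nR) : R := (a^T *m map_mx intr (body_mx (body P)))%R ord0 k.
Let surv := survival (joint_law P) (increment alpha).

Hypothesis guard_gt0 : forall v, guard P v -> (0 < h v)%R.

Lemma progress_body_fun v u :
  h (body_fun (body P) v u) = (h v + increment alpha u)%R.
Proof.
rewrite body_funE /h map_mxD map_mxM mulmxDr mulmxA mxE addrAC; congr (_ + _)%R.
by rewrite mxE; apply: eq_bigr => k _; congr (_ * _)%R; rewrite mxE.
Qed.

Lemma transition_ge0 s s' : 0 <= transition P s s'.
Proof.
case: s => -[] v /=; last by rewrite lee_fin.
case: ifP => _; last by rewrite lee_fin.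
by case: s' => -[] v' //; apply: esum_ge0 => u _; exact: joint_pmf_ge0.
Qed.

Lemma surv_ge0 n x : (0 <= surv n x)%R.
Proof.
by have /andP[] := @survival_itv _ _ _ (joint_law P) (increment alpha) (fun _ => I) n x.
Qed.

(** Under a true guard this is an equality, the next valuation being the image of the joint law by
    the body. Under a false guard no mass stays inside, whatever the sign of [h v], hence only an
    inequality. *)
Lemma transition_survival m v :
  \esum_(v' in [set: 'cV[int]_nX]) (transition P (Lin, v) (Lin, v') * (surv m (h v'))%:E)
  <= (surv m.+1 (h v))%:E.
Proof.
rewrite /transition; have [gv|/negbTE gv] := boolP (guard P v); last first.
  rewrite esum1 ?lee_fin ?surv_ge0// => v' _; rewrite /= indicE memNset ?mul0e//=.
rewrite [surv m.+1 _]survivalE (guard_gt0 gv).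
rewrite /Rintegral fineK; last first.
  apply: integrable_fin_num => //.
  exact: (@survival_int _ _ _ (joint_law P) (increment alpha) (fun _ => I)).
rewrite le_eqVlt; apply/orP; left; apply/eqP.
under [RHS]eq_integral do rewrite -progress_body_fun.
rewrite (@ge0_integral_esum R _ (sample_space nR) 'cV[int]_nX (joint_law P)
  (fun u => body_fun (body P) v u) (fun v' => (surv m (h v'))%:E))//; last first.
  by move=> v'; rewrite lee_fin surv_ge0.
by apply: eq_esum => v' _; rewrite muleC.
Qed.

Context (d : measure_display) (Omega : measurableType d) (Pr : probability Omega R).
Variables (s0 : configuration nX) (X : nat -> Omega -> configuration nX).
Hypothesis chain : loop_chain P Pr s0 X.

Lemma measurable_forall (B : nat -> Prop) (Q : nat -> set Omega) :
  (forall i, measurable (Q i)) -> measurable [set w | forall i, B i -> Q i w].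
Proof.
move=> mQ; rewrite (_ : [set _ | _] = \bigcap_i [set w | B i -> Q i w]).
  apply: bigcapT_measurable => i; have [Bi|nB] := pselect (B i).
    by rewrite (_ : [set _ | _] = Q i)//; apply/seteqP; split=> w /=; [exact|].
  by rewrite (_ : [set _ | _] = setT)//; apply/seteqP; split=> w // _ /= /nB.
by apply/seteqP; split=> w /= H i; [move=> _|]; exact: H.
Qed.

Lemma measurable_Lin i : measurable [set w | (X i w).1 = Lin].
Proof.
rewrite (_ : [set _ | _] = \bigcup_v (X i @^-1` [set (Lin, v)])).
  rewrite -bigcup_pick_index; apply: bigcupT_measurable => n.
  by rewrite /pick_index; case: pickle_inv => // v; exact: (chain_measurable chain).
apply/seteqP; split=> w /=; last by move=> [v _ ->].
by case E : (X i w) => [l v] /= ll; exists v => //; rewrite /= E ll.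
Qed.

(** Fixing a whole prefix of the path, not just its last state, matches the form of [chain_step].
    The induction on [m] moves the next state into the prefix, so it generalizes over [n] and
    [s]. *)
Lemma path_survival m n (s : nat -> configuration nX) v : s n = (Lin, v) ->
  Pr [set w | (forall i, (i <= n)%N -> X i w = s i) /\
              (forall i, (n < i <= n + m)%N -> (X i w).1 = Lin)] <=
  Pr [set w | forall i, (i <= n)%N -> X i w = s i] * (surv m (h v))%:E.
Proof.
have mpath k (t : nat -> configuration nX) :
    measurable [set w | forall i, (i <= k)%N -> X i w = t i].
  by apply: measurable_forall => i; exact: (chain_measurable chain).
have mLin k l : measurable [set w | forall i, (k < i <= l)%N -> (X i w).1 = Lin].
  by apply: measurable_forall => i; exact: measurable_Lin.
elim: m n s v => [|m IH] n s v sn.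
  rewrite mule1; apply: le_measure; rewrite ?inE//.
    exact: (measurableI _ _ (mpath n s) (mLin _ _)).
  by move=> w [].
pose s' v' i := if i == n.+1 then (Lin, v') else s i.
pose E v' := [set w | (forall i, (i <= n.+1)%N -> X i w = s' v' i) /\
              (forall i, (n.+1 < i <= n.+1 + m)%N -> (X i w).1 = Lin)].
(* The surviving paths are sorted by their valuation at time [n + 1]. *)
rewrite (_ : [set _ | _] = \bigcup_v' E v'); last first.
  apply/seteqP; split=> w /=.
    move=> [Xs XL]; have : (X n.+1 w).1 = Lin.
      by apply: XL; rewrite ltnSn addnS ltnS leq_addr.
    case EX : (X n.+1 w) => [l v'] /= ll; exists v' => //; split=> i.
      rewrite /s' leq_eqVlt; case: eqP => [-> _|_ /= ?]; first by rewrite EX ll.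
      exact: Xs.
    move=> /andP[ni im]; apply: XL; rewrite (ltn_trans _ ni)//=.
    by rewrite addnS -addSn.
  move=> [v' _ [Xs XL]]; split=> i.
    by move=> ni; rewrite Xs ?(leq_trans ni)// /s' ltn_eqF// ltnS.
  move=> /andP[ni im]; have [->|/eqP ni'] := eqVneq i n.+1.
    by rewrite Xs// /s' eqxx.
  apply: XL; rewrite addSn -addnS im andbT ltn_neqAle ni andbT eq_sym.
  exact/eqP.
have mE v' : measurable (E v') by exact: (measurableI _ _ (mpath _ _) (mLin _ _)).
rewrite measure_bigcup_esum//; last first.
  apply/trivIsetP => v1 v2 _ _ /eqP v12; apply/seteqP; split=> // w [[E1 _] [E2 _]].
  apply: v12; have := E1 n.+1 (leqnn _); rewrite (E2 n.+1 (leqnn _)) /s' eqxx.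
  by case.
have pfin : Pr [set w | forall i, (i <= n)%N -> X i w = s i] \is a fin_num.
  exact: fin_num_measure.
have step v' : Pr (E v') <= Pr [set w | forall i, (i <= n)%N -> X i w = s i] *
    (transition P (Lin, v) (Lin, v') * (surv m (h v'))%:E).
  apply: (le_trans (IH n.+1 (s' v') v' _)); first by rewrite /s' eqxx.
  rewrite (chain_step chain) muleA.
  rewrite (_ : s' v' n.+1 = (Lin, v')); last by rewrite /s' eqxx.
  rewrite (_ : s' v' n = (Lin, v)); last by rewrite /s' ltn_eqF.
  rewrite (_ : [set w | forall i, (i <= n)%N -> X i w = s' v' i] =
    [set w | forall i, (i <= n)%N -> X i w = s i])//.
  by apply/seteqP; split=> w /= H i ni; rewrite H// /s' ltn_eqF// ltnS.
apply: (le_trans (le_esum (fun v' _ => step v'))).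
rewrite -(fineK pfin) esumZl ?fine_ge0//.
  by apply: lee_wpmul2l; [rewrite lee_fin fine_ge0|exact: transition_survival].
by move=> v'; rewrite mule_ge0 ?transition_ge0// lee_fin surv_ge0.
Qed.

End LoopChain.

(** * Almost-sure termination from vanishing survival probabilities *)

Local Open Scope ereal_scope.

Theorem theorem13 (R : realType) (nX nR : nat) (P : incremental_loop R nX nR)
    (fin_var : finite_variance P)
    (progress : exists h : 'cV[int]_nX -> R, linear_progress_function P h)
    (v0 : 'cV[int]_nX)
    (d : measure_display) (Omega : measurableType d) (Pr : probability Omega R)
    (X : nat -> Omega -> configuration nX)
    (chain : loop_chain P Pr (Lin, v0) X) :
  Pr [set w | termination_time R X w < +oo] = 1.
Proof.
have [h [a [c [hE guard_gt0 drift spread]]]] := progress.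
pose surv := survival (joint_law P)
  (increment (fun k => (a^T *m map_mx intr (body_mx (body P)))%R ord0 k)).
have surv_cvg : surv ^~ (h v0) @ \oo --> (0 : R)%R.
  apply: survival_cvg0 => //.
  - exact: increment_integrable.
  - by rewrite Rintegral_increment.
  - exact: Rintegral_norm_increment_gt0.
(* The premise [True] gives the event the shape expected by [measurable_forall]. *)
pose alive := [set w | forall i, True -> (X i w).1 = Lin].
have malive : measurable alive.
  by apply: measurable_forall => i; exact: measurable_Lin chain _.
pose start := X 0%N @^-1` [set (Lin, v0)].
have mstart : measurable start by exact: (chain_measurable chain).
have Pstart : Pr (~` start) = 0.
  by rewrite probability_setC// (chain_init chain) subee.
have guard_gt0' v : guard P v -> (0 < (a^T *m map_mx intr v) ord0 ord0 + c)%R.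
  by move=> gv; rewrite -hE; exact: guard_gt0.
(* Never leaving implies staying inside for [m] steps, so [path_survival] applies with the prefix
   reduced to time 0. *)
have bound m : Pr (alive `&` start) <= (surv m (h v0))%:E.
  have := path_survival guard_gt0' chain m (n := 0) (s := fun=> (Lin, v0)) erefl.
  rewrite -hE -/surv => le_surv.
  have surv_ge0 : (0 <= surv m (h v0))%R.
    by have /andP[] := @survival_itv _ _ _ (joint_law P)
      (increment (fun k => (a^T *m map_mx intr (body_mx (body P)))%R ord0 k))
      (fun _ => Logic.I) m (h v0).
  have le1 := lee_wpmul2r (_ : 0 <= (surv m (h v0))%:E)
    (probability_le1 Pr (_ : measurable [set w | forall i, (i <= 0)%N -> X i w = (Lin, v0)])).
  rewrite mul1e in le1.
  apply: le_trans (le_trans le_surv (le1 _ _)).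
  - apply: le_measure; rewrite ?inE; first exact: measurableI.
      apply: measurableI; apply: measurable_forall => i.
        exact: (chain_measurable chain).
      exact: measurable_Lin chain _.
    move=> w [/= wL w0]; split=> [i|i _]; last exact: wL.
    by rewrite leqn0 => /eqP ->.
  - by rewrite lee_fin.
  - by apply: measurable_forall => i; exact: (chain_measurable chain).
have Palive : Pr alive = 0.
  have : Pr (alive `&` start) = 0.
    apply/eqP; rewrite eq_le measure_ge0 andbT.
    rewrite -(fineK (fin_num_measure Pr _ (measurableI _ _ malive mstart))) lee_fin.
    apply: (cvg_ge_cst surv_cvg) => m.
    by rewrite -lee_fin fineK ?bound// fin_num_measure//; exact: measurableI.
  (* The initial state is prescribed only almost surely, so the null complement of [start] is added
     to cover [alive]. *)
  move=> alive_start; apply/eqP; rewrite eq_le measure_ge0 andbT.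
  rewrite -[leRHS]adde0 -{1}alive_start -Pstart.
  apply: le_trans (measureU2 _ (measurableI _ _ malive mstart) (measurableC mstart)).
  apply: le_measure; rewrite ?inE//.
    by apply: measurableU; [exact: measurableI|exact: measurableC].
  by move=> w wL; have [ws|ws] := pselect (start w); [left|right].
rewrite (_ : [set _ | _] = ~` alive); first by rewrite probability_setC// Palive sube0.
apply/seteqP; split=> w /=.
  rewrite /termination_time => fin wL.
  (* On a path that never leaves, the infimum is over the empty set, hence infinite. *)
  rewrite (_ : [set n | _] = set0) ?image_set0 ?ereal_inf0 ?ltxx// in fin.
  by apply/seteqP; split=> // n /=; rewrite (wL n Logic.I).
move=> /existsNP[n] /not_implyP[_ XL].
apply: (@le_lt_trans _ _ n%:R%:E); last exact: ltry.
apply: ereal_inf_lbound; exists n => //=.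
by case: (X n w).1 XL.
Qed.
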